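(* Let $H$ be a dag which is not a rooted star and let $a^*>a(H)$. There is a constant $c^*=c^*(a^*,H)>0$ such that asymptotically almost surely $G\sim\vec G(n,n^{-1/a^*})$ satisfies $\tau(H,G)\ge c^*\log n$. In particular, asymptotically almost surely $\tau(H,G)=\Theta(\log n)$.
   Context: All graphs are simple finite directed graphs; $H$ has at least two edges and no isolated vertices. A dag is a directed graph with no directed cycle. $H$ is a rooted star if its underlying undirected graph is a star and the center is either a source or a sink. The fractional arboricity of $H$ is $a(H)=\max\{|E(H')|/(|V(H')|-1)\}$ over all subgraphs $H'$ of $H$ with at least two vertices. $\vec G(n,p)$ is the random directed graph on $[n]$ in which each of the $n(n-1)$ ordered pairs is an edge independently with probability $p$; ''asymptotically almost surely'' means with probability tending to $1$ as $n\to\infty$. For a directed graph $G$ and a permutation $\pi$ of $V(G)$, $G_L(\pi)$ is the spanning subgraph with edges $\{(i,j)\in E(G):\pi(i)<\pi(j)\}$; an $H$-copy of $G$ is covered by $\pi$ if it is a subgraph of $G_L(\pi)$. $\tau(H,G)$ is the minimum $t$ such that some $t$ permutations of $V(G)$ cover every $H$-copy of $G$ (each copy by at least one of them). Logarithms are base 2. *)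

(* Defs.v *)
From HB Require Import structures.
From mathcomp Require Import all_boot all_order all_algebra all_fingroup.
From mathcomp Require Import all_classical all_reals all_analysis.
Set Implicit Arguments. Unset Strict Implicit. Unset Printing Implicit Defensive.
Import Order.TTheory GRing.Theory Num.Theory.
Import numFieldNormedType.Exports.
Local Open Scope ring_scope.

Section Digraph.
Variable V : finType.
Implicit Type A : {set V * V}.

Definition loopless A : bool := [forall e in A, e.1 != e.2].

(* Simple directed graphs on V: no loops, and parallel edges are excluded by
   the encoding, but antiparallel pairs (u, v), (v, u) are allowed. *)
Record digraph := Digraph { edges :> {set V * V}; _ : loopless edges }.

HB.instance Definition _ := [isSub for edges].
HB.instance Definition _ := [Finite of digraph by <:].

Definition adj (G : digraph) : rel V := fun u v => (u, v) \in edges G.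

Definition dag (G : digraph) : Prop :=
  forall s : seq V, ucycle (adj G) s -> s = [::].

Definition no_isolated (G : digraph) : Prop :=
  forall v, exists u, adj G u v || adj G v u.

Definition star_with_center (G : digraph) (c : V) : Prop :=
  forall u v, (adj G u v || adj G v u) = (u != v) && ((u == c) || (v == c)).

Definition source (G : digraph) (c : V) : Prop := forall u, ~~ adj G u c.
Definition sink (G : digraph) (c : V) : Prop := forall u, ~~ adj G c u.

Definition rooted_star (G : digraph) : Prop :=
  exists c, star_with_center G c /\ (source G c \/ sink G c).

(* A subgraph is given by its vertex set X.1 and its edge set X.2. *)
Definition subgraph (X : {set V} * {set V * V}) (G : digraph) : bool :=
  (X.2 \subset edges G) && [forall e in X.2, (e.1 \in X.1) && (e.2 \in X.1)].

(* The ratios are nonnegative, so the default value 0 of the maximum only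
   matters when V has fewer than two vertices. *)
Definition frac_arboricity (R : realType) (G : digraph) : R :=
  \big[Num.max/0]_(X : {set V} * {set V * V}
                   | subgraph X G && (1 < #|X.1|)%N)
    (#|X.2|%:R / (#|X.1|%:R - 1)).

End Digraph.

Definition is_copy (W V : finType) (H : digraph W) (G : digraph V)
    (X : {set V} * {set V * V}) : bool :=
  subgraph X G &&
  [exists f : {ffun W -> V},
     [&& injectiveb f, X.1 == [set f w | w : W]
       & X.2 == [set (f e.1, f e.2) | e in edges H]]].

Section Cover.
Variables (n : nat) (W : finType).
Implicit Types (H : digraph W) (G : digraph 'I_n) (pi : 'S_n).

Definition forward_edges G pi : {set 'I_n * 'I_n} :=
  [set e in edges G | (pi e.1 < pi e.2)%N].

Fact forward_loopless G pi : loopless (forward_edges G pi).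
Proof.
apply/forall_inP => -[i j]; rewrite inE /= => /andP[_].
by apply: contraTneq => ->; rewrite ltnn.
Qed.

Definition GL G pi : digraph 'I_n := Digraph (forward_loopless G pi).

Definition covers H G t (ps : t.-tuple 'S_n) : bool :=
  [forall X : {set 'I_n} * {set 'I_n * 'I_n},
     is_copy H G X ==> has (fun pi => subgraph X (GL G pi)) ps].

Definition coverable H G (t : nat) : bool :=
  [exists ps : t.-tuple 'S_n, covers H G ps].

(* The value 0 in the second branch is junk: no number of permutations covers
   a copy of a graph with a directed cycle. For a dag it is never used, see
   dag_coverable. *)
Definition tau H G : nat :=
  if pselect (exists t, coverable H G t) is left ex then ex_minn ex else 0%N.

Lemma dag_edge_connect H u v : dag H -> adj H u v -> ~~ connect (adj H) v u.
Proof.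
move=> dH uv; apply/negP => /connectP[p pp up].
move: uv; rewrite up; case/shortenP: pp => q pq uq _ uv.
have := dH (v :: q); rewrite /ucycle /= rcons_path pq uv.
by move=> /(_ uq).
Qed.

Lemma perm_of_key (k : 'I_n -> nat) :
  exists pi : 'S_n, forall i j, (k i < k j)%N -> (pi i < pi j)%N.
Proof.
pose r : rel 'I_n := fun i j => (k i <= k j)%N.
have rT : total r by move=> i j; exact: leq_total.
have rtr : transitive r by move=> j i l; exact: leq_trans.
pose s := sort r (enum 'I_n).
have szs : size s = n by rewrite size_sort size_enum_ord.
have ins i : i \in s by rewrite mem_sort mem_enum.
have lts i : (index i s < n)%N by rewrite -[ltnRHS]szs index_mem.
pose g i := Ordinal (lts i).
have gI : injective g.
  by move=> i j /(congr1 val) /= /(congr1 (nth i s)); rewrite !nth_index.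
exists (perm gI) => i j kij; rewrite !permE /= ltnNge.
apply: contraTN kij => ji; rewrite -leqNgt.
have := sorted_leq_nth rtr (fun x => leqnn (k x)) i (sort_sorted rT (enum 'I_n)).
move=> /(_ (index j s) (index i s)); rewrite !inE -/s !index_mem !ins.
by move=> /(_ isT isT ji); rewrite !nth_index.
Qed.

Lemma dag_coverable H G : dag H -> exists t, coverable H G t.
Proof.
move=> dH; exists (size (enum 'S_n)).
apply/existsP; exists (in_tuple (enum 'S_n)).
apply/forallP => X; apply/implyP => /andP[/andP[XG Xends]].
case/existsP => f /and3P[/injectiveP fI _ /eqP XE].
pose rk w := #|[pred u | connect (adj H) u w]|.
pose k i := if [pick w | f w == i] is Some w then rk w else 0%N.
have kf w : k (f w) = rk w.
  rewrite /k; case: pickP => [w' /eqP/fI -> //|/(_ w)]; by rewrite eqxx.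
have [pi piP] := perm_of_key k.
apply/hasP; exists pi; first by rewrite mem_enum.
rewrite /subgraph Xends andbT; apply/fintype.subsetP => e eX.
rewrite /= inE (fintype.subsetP XG) //=; apply: piP.
move: eX; rewrite XE => /imsetP[[u v] uv ->] /=; rewrite !kf.
apply: proper_card; apply/properP; split.
  apply/fintype.subsetP => w; rewrite !inE => wu.
  by apply: connect_trans wu _; apply: connect1.
by exists v; rewrite inE ?connect0 //; exact: dag_edge_connect.
Qed.

End Cover.

Local Open Scope classical_set_scope.

Section RandomDigraph.
Variable R : realType.

Definition gnp_weight (n : nat) (p : R) (G : digraph 'I_n) : R :=
  \prod_(e : 'I_n * 'I_n | e.1 != e.2) (if e \in edges G then p else 1 - p).

Definition gnp_prob (n : nat) (p : R) (P : pred (digraph 'I_n)) : R :=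
  \sum_(G : digraph 'I_n | P G) gnp_weight p G.

Definition aas (p : nat -> R) (P : forall n, pred (digraph 'I_n)) : Prop :=
  gnp_prob (p n) (P n) @[n --> \oo] --> (1 : R).

Definition log2 (x : R) : R := ln x / ln 2.

End RandomDigraph.

(* Main.v *)
(* Since [H] is a dag but not a rooted star, some bipartition of its vertices
   is crossed by edges in both directions. Any [t] permutations admit two
   disjoint vertex sets [A], [B] of size about [n / 2 ^ t] such that every
   permutation puts all of [A] on one side of all of [B] (halve both sets once
   per permutation), and no copy of [H] spread over [A] and [B] along that
   bipartition is then covered. If [t <= c log n], these sets have size
   [m = n ^ (1 - d)] up to a constant factor. Cut them into pieces indexed by
   the vertices of [H]. For every [K] spanning an edge of [H], the bound
   [e(K) <= a(H) (|K| - 1)] makes [m ^ |K| * p ^ e(K)] at least [n ^ (1 + eps)],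
   so by Janson's inequality given pieces contain no copy of [H] with
   probability at most [exp (- const * n ^ (1 + eps))], which beats the
   [2 ^ (n |H|)] choices of the pieces. For the upper bound, a random colouring
   of the vertices by [|H|] ordered colours covers a given copy with probability
   at least [|H| ^ - |H|], so greedily chosen colourings cover all copies after
   [O(log n)] steps. *)
Require Import Defs.
From HB Require Import structures.
From mathcomp Require Import all_boot all_order all_algebra all_fingroup.
From mathcomp Require Import all_classical all_reals all_analysis.
From mathcomp Require Import zify ring lra.
Set Implicit Arguments. Unset Strict Implicit. Unset Printing Implicit Defensive.
Import Order.TTheory GRing.Theory Num.Theory.
Import numFieldNormedType.Exports.
Local Open Scope ring_scope.

(** * Product measures on subsets and the Janson inequality *)

Definition subset_weight (R : realType) (T : finType) (p : T -> R)
  (A : {set T}) : R := \prod_e (if e \in A then p e else 1 - p e).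

Definition mean (R : realType) (T : finType) (p : T -> R)
  (g : {set T} -> R) : R := \sum_A subset_weight p A * g A.

Lemma subset_weight_ge0 (R : realType) (T : finType) (p : T -> R) A :
  (forall e, 0 <= p e <= 1) -> 0 <= subset_weight p A.
Proof.
move=> p01; apply: prodr_ge0 => e _; have /andP[p0 p1] := p01 e.
by case: ifP => _ //; rewrite subr_ge0.
Qed.

Lemma sum_subset_weight (R : realType) (T : finType) (p : T -> R) :
  \sum_A subset_weight p A = 1.
Proof.
transitivity (\prod_(e : T) (p e + (1 - p e))).
  by rewrite bigA_distr; apply: eq_bigl => A; rewrite inE.
by apply: big1 => e _; rewrite addrC subrK.
Qed.

Lemma eq_mean (R : realType) (T : finType) (p : T -> R) f g :
  f =1 g -> mean p f = mean p g.
Proof. by move=> fg; apply: eq_bigr => A _; rewrite fg. Qed.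

Lemma le_mean (R : realType) (T : finType) (p : T -> R) f g :
  (forall e, 0 <= p e <= 1) -> (forall A, f A <= g A) -> mean p f <= mean p g.
Proof.
by move=> p01 fg; apply: ler_sum => A _; apply/ler_wpM2l/fg/subset_weight_ge0.
Qed.

Lemma mean_ge0 (R : realType) (T : finType) (p : T -> R) f :
  (forall e, 0 <= p e <= 1) -> (forall A, 0 <= f A) -> 0 <= mean p f.
Proof.
by move=> p01 f0; apply: sumr_ge0 => A _; rewrite mulr_ge0 ?subset_weight_ge0.
Qed.

Lemma meanB (R : realType) (T : finType) (p : T -> R) f g :
  mean p (fun A => f A - g A) = mean p f - mean p g.
Proof. by rewrite /mean -sumrB; apply: eq_bigr => A _; rewrite mulrBr. Qed.

Lemma meanZ (R : realType) (T : finType) (p : T -> R) c f :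
  mean p (fun A => c * f A) = c * mean p f.
Proof. by rewrite /mean mulr_sumr; apply: eq_bigr => A _; rewrite mulrCA. Qed.

Lemma mean_sum (R : realType) (T I : finType) (p : T -> R) (s : seq I)
    (P : pred I) (f : I -> {set T} -> R) :
  mean p (fun A => \sum_(i <- s | P i) f i A) = \sum_(i <- s | P i) mean p (f i).
Proof.
by rewrite /mean exchange_big; apply: eq_bigr => A _; rewrite mulr_sumr.
Qed.

(** Adding [e] matches the sets avoiding [e] with those containing it and trades the factor
    [1 - p e] for [p e]. Nothing is divided by [p e], so [p e = 0] is allowed. *)
Lemma mean_mem (R : realType) (T : finType) (p : T -> R) e g :
  mean p (fun A => (e \in A)%:R * g A) = p e * mean p (fun A => g (e |: A)).
Proof.
rewrite /mean (bigID (fun A : {set T} => e \in A)) /= [X in _ + X]big1 ?addr0; last first.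
  by move=> A /negPf ->; rewrite mul0r mulr0.
rewrite [in RHS](bigID (fun A : {set T} => e \in A)) /= mulrDr.
have -> : p e * (\sum_(A : {set T} | e \notin A) subset_weight p A * g (e |: A)) =
    (1 - p e) * \sum_(A : {set T} | e \in A) subset_weight p A * g A.
  rewrite !mulr_sumr [RHS](reindex_onto (fun A => e |: A) (fun A => A :\ e)) /=; last first.
    by move=> A eA; rewrite finset.setD1K.
  apply: eq_big => [A|A eA].
    rewrite finset.setU11 /=; apply/idP/eqP => [eA|<-]; last by rewrite finset.setD11.
    by rewrite finset.setU1K.
  rewrite !mulrA; congr (_ * _); rewrite /subset_weight (bigD1 e) //=.
  rewrite [in RHS](bigD1 e) //= finset.setU11 (negPf eA) mulrA [RHS]mulrA.
  rewrite [p e * _]mulrC; congr (_ * _); apply: eq_bigr => x xe.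
  by rewrite finset.in_setU1 (negPf xe).
have -> : \sum_(A : {set T} | e \in A) subset_weight p A * g (e |: A) =
   \sum_(A : {set T} | e \in A) subset_weight p A * g A.
  by apply: eq_bigr => A eA; rewrite (finset.setUidPr _) // finset.sub1set.
rewrite -mulrDl addrC subrK mul1r.
by apply: eq_bigr => A ->; rewrite mul1r.
Qed.

(* Conditioning a product measure on [S \subset A] amounts to forcing the
   elements of S; this replaces the Harris inequality in what follows. *)
Lemma mean_subset (R : realType) (T : finType) (p : T -> R) (S : {set T}) g :
  mean p (fun A => (S \subset A)%:R * g A) =
  (\prod_(e in S) p e) * mean p (fun A => g (S :|: A)).
Proof.
have [k] := ubnP #|S|; elim: k => // k IH in S g *.
have [->|[e eS]] := finset.set_0Vmem S.
  move=> _; rewrite big_set0 mul1r; apply: eq_mean => A.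
  by rewrite finset.sub0set mul1r finset.set0U.
rewrite (cardsD1 e) eS add1n ltnS => ltk.
rewrite (eq_mean _ (g := fun A => (e \in A)%:R * ((S :\ e \subset A)%:R * g A))); last first.
  move=> A; rewrite mulrA; congr (_ * _); rewrite -{1}(finset.setD1K eS) finset.subUset finset.sub1set.
  by case: (e \in A); rewrite ?mul1r ?mul0r.
rewrite mean_mem.
rewrite (eq_mean _ (g := fun A => (S :\ e \subset A)%:R * g (e |: A))); last first.
  by move=> A; rewrite -finset.subDset finset.setDDl finset.setUid.
rewrite IH // mulrA; congr (_ * _); first by rewrite [RHS](finset.big_setD1 e eS).
by apply: eq_mean => A; rewrite finset.setUA finset.setD1K.
Qed.

(** The Weierstrass product inequality; with scaled indicators for [x i] it acts as a union
    bound. *)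
Lemma prod_onem_ge (R : realType) (I : Type) (s : seq I) (P : pred I) (x : I -> R) :
  (forall i, 0 <= x i <= 1) ->
  1 - \sum_(i <- s | P i) x i <= \prod_(i <- s | P i) (1 - x i).
Proof.
move=> x01; elim: s => [|i s IH]; first by rewrite !big_nil subr0.
rewrite !big_cons; case: ifP => // _.
have S0 : 0 <= \sum_(j <- s | P j) x j.
  by apply: sumr_ge0 => j _; case/andP: (x01 j).
have /andP[x0 x1] := x01 i.
apply: (@le_trans _ _ ((1 - x i) * (1 - \sum_(j <- s | P j) x j))).
  have := mulr_ge0 x0 S0; lra.
by apply: ler_wpM2l => //; rewrite subr_ge0.
Qed.

(* The factor [q] thins the family: the linear term scales with [q] and the
   quadratic one with [q ^ 2], so a small [q] helps when the latter dominates. *)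
Lemma janson_seq (R : realType) (T I : finType) (p : T -> R) (S : I -> {set T})
    (q : R) (J : {set I}) (s : seq I) :
  (forall e, 0 <= p e <= 1) -> 0 <= q <= 1 -> uniq s -> {subset s <= J} ->
  mean p (fun A => \prod_(i <- s) (1 - q * (S i \subset A)%:R)) <=
  expR (\sum_(i <- s) (- (q * \prod_(e in S i) p e) +
     q ^+ 2 * \sum_(j in J | ~~ [disjoint S i & S j]) \prod_(e in S i :|: S j) p e)).
Proof.
move=> p01 /andP[q0 q1]; elim: s => [_ _|i s IH].
  rewrite !big_nil expR0 /mean.
  by under eq_bigr do rewrite big_nil mulr1; rewrite sum_subset_weight.
move=> /andP[_ us] sJ; have {}sJ j : j \in s -> j \in J.
  by move=> js; apply: sJ; rewrite in_cons js orbT.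
have {}IH := IH us sJ.
pose x (j : I) (A : {set T}) : R := q * (S j \subset A)%:R.
have x01 j A : 0 <= x j A <= 1.
  by rewrite /x; case: (_ \subset _); rewrite ?mulr1 ?mulr0 ?lexx ?ler01 ?q0 ?q1.
have x'01 j A : 0 <= 1 - x j A <= 1.
  by have := x01 j A; rewrite subr_ge0 lerBlDr lerDl andbC.
(* [D] keeps the indices whose sets are disjoint from [S i], so it is independent of the event
   [S i \subset A]; [N] keeps the others. *)
pose nb (j : I) := ~~ [disjoint S i & S j].
pose F (A : {set T}) : R := \prod_(j <- s) (1 - x j A).
pose D (A : {set T}) : R := \prod_(j <- s | ~~ nb j) (1 - x j A).
pose N (A : {set T}) : R := \prod_(j <- s | nb j) (1 - x j A).
have FE A : F A = N A * D A by rewrite /F (bigID nb).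
have D0 A : 0 <= D A by apply: prodr_ge0 => j _; case/andP: (x'01 j A).
have F0 A : 0 <= F A by apply: prodr_ge0 => j _; case/andP: (x'01 j A).
have Pr0 B : 0 <= \prod_(e in B) p e.
  by apply: prodr_ge0 => e _; case/andP: (p01 e).
have DU A B : D (B :|: A) <= D A.
  apply: ler_prod => j _; case/andP: (x'01 j (B :|: A)) => -> _ /=.
  rewrite lerD2l lerN2 ler_wpM2l // ler_nat.
  case: (boolP (S j \subset A)) => // /fintype.subset_trans -> //.
  exact: finset.subsetUr.
have Di A : D (S i :|: A) = D A.
  apply: eq_bigr => j; rewrite negbK disjoint_sym => /finset.setDidPl dj.
  by rewrite /x -finset.subDset dj.
have FD A : F A <= D A.
  rewrite FE; apply: ler_piMl => //; apply: (@le_trans _ _ (\prod_(j <- s | nb j) 1)); last by rewrite big1_eq.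
  by apply: ler_prod => j _; exact: x'01.
(* On the event [S i \subset A], [prod_onem_ge] bounds [1 - N A] by [q] times the number of
   neighbours [j] that occur. Since [D] only decreases when [S i :|: S j] is forced into [A], each
   neighbour costs at most its joint probability times the mean of [D]. *)
pose b := \prod_(e in S i) p e -
  q * \sum_(j <- s | nb j) \prod_(e in S i :|: S j) p e.
have key : b * mean p D <= mean p (fun A => (S i \subset A)%:R * F A).
  apply: (@le_trans _ _ (mean p (fun A => (S i \subset A)%:R * D A -
      q * \sum_(j <- s | nb j) ((S i :|: S j \subset A)%:R * D A)))).
    rewrite meanB mean_subset meanZ mean_sum mulrBl; apply: lerB.
      by rewrite (eq_mean _ Di).
    rewrite -mulrA ler_wpM2l // mulr_suml; apply: ler_sum => j _.
    by rewrite mean_subset; apply: ler_wpM2l => //; exact: le_mean.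
  apply: le_mean => // A; rewrite FE.
  have := prod_onem_ge s nb (fun j => x01 j A); rewrite -/(N A) => NA.
  case: (boolP (S i \subset A)) => SA; last first.
    rewrite !mul0r sub0r oppr_le0 mulr_ge0 //.
    by apply: sumr_ge0 => j _; rewrite mulr_ge0.
  rewrite !mul1r; apply: le_trans (ler_wpM2r (D0 A) NA).
  rewrite mulrBl mul1r lerD2l lerN2 /x -mulr_sumr -mulrA ler_wpM2l // mulr_suml.
  by apply: ler_sum => j _; rewrite finset.subUset SA.
(* For [b >= 0] the passage from [D] to [F] uses [F <= D]; for negative [b] the left side is at most
   0. *)
have key2 : b * mean p F <= mean p (fun A => (S i \subset A)%:R * F A).
  have [b0|b0] := leP 0 b.
    by apply: le_trans key; apply: ler_wpM2l => //; apply: le_mean.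
  apply: (@le_trans _ _ 0).
    by rewrite mulr_le0_ge0 ?(ltW b0) // mean_ge0.
  by apply: mean_ge0 => // A; rewrite mulr_ge0.
rewrite (eq_mean _ (g := fun A => F A - q * ((S i \subset A)%:R * F A))); last first.
  by move=> A; rewrite big_cons -/(F A) mulrBl mul1r mulrA.
rewrite meanB meanZ big_cons expRD.
apply: (@le_trans _ _ (expR (- (q * b)) * mean p F)).
  apply: (@le_trans _ _ ((1 - q * b) * mean p F)).
    by rewrite mulrBl mul1r lerD2l lerN2 -mulrA ler_wpM2l.
  by apply: ler_wpM2r; [exact: mean_ge0 | exact: expR_ge1Dx].
apply: ler_pM => //; first exact: mean_ge0.
rewrite ler_expR /b mulrBr opprB addrC lerD2l mulrA -expr2.
apply: ler_wpM2l; first exact: sqr_ge0.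
rewrite -big_filter big_uniq ?filter_uniq //=.
rewrite big_mkcond [leRHS]big_mkcond; apply: ler_sum => j _.
rewrite mem_filter -/(nb j); case: (nb j) => /=; rewrite ?andbF // andbT.
by case: ifP => [/sJ ->|_] //; case: ifP.
Qed.

(** The inner sum contains the diagonal term [j = i] whenever [S i] is nonempty. The thinning
    parameter stays free; at [q = mu / (2 * Delta)], when this is at most 1, the exponent is
    [- mu ^+ 2 / (4 * Delta)]. *)
Lemma janson (R : realType) (T I : finType) (p : T -> R) (S : I -> {set T})
    (J : {set I}) (mu Delta q : R) :
  (forall e, 0 <= p e <= 1) -> 0 <= q <= 1 ->
  \sum_(i in J) \prod_(e in S i) p e = mu ->
  \sum_(i in J) \sum_(j in J | ~~ [disjoint S i & S j])
     \prod_(e in S i :|: S j) p e <= Delta ->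
  \sum_(A : {set T} | [forall i in J, ~~ (S i \subset A)]) subset_weight p A <=
  expR (- (q * mu) + q ^+ 2 * Delta).
Proof.
move=> p01 q01 <- HD.
have sJ : {subset enum J <= J} by move=> i; rewrite mem_enum.
apply: le_trans (le_trans (janson_seq S p01 q01 (enum_uniq J) sJ) _).
  rewrite /mean big_mkcond; apply: ler_sum => A _.
  case: ifP => [/forall_inP nS|_].
    rewrite big_seq big1 ?mulr1 // => i /sJ iJ.
    by rewrite (negPf (nS i iJ)) mulr0 subr0.
  rewrite mulr_ge0 ?subset_weight_ge0 // prodr_ge0 // => i _.
  case/andP: q01 => q0 q1; case: (_ \subset _); rewrite ?mulr1 ?mulr0 ?subr0 //.
  by rewrite subr_ge0.
rewrite big_enum /= ler_expR big_split /= sumrN -mulr_sumr lerD2l -mulr_sumr.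
by apply: ler_wpM2l => //; exact: sqr_ge0.
Qed.

(** * Permutations separating two large sets *)

Definition two_way_cut (W : finType) (H : digraph W) (side : W -> bool) : Prop :=
  (exists u v, [/\ adj H u v, side u & ~~ side v]) /\
  (exists u v, [/\ adj H u v, ~~ side u & side v]).

Lemma adj_neq (V : finType) (G : digraph V) u v : adj G u v -> u != v.
Proof.
by case: G => E lE /=; rewrite /adj /= => uv; have /forall_inP/(_ _ uv) := lE.
Qed.

(** Contrapositive. If two edges share neither tail nor head, the set formed by the tail of the
    first and the head of the second is left by the first edge and entered by the second. So without
    a two-way cut any two edges share a tail or a head. Two distinct edges with a common tail have
    different heads, so a third edge, meeting both, has that tail too; likewise for heads. *)
Lemma two_way_cut_exists (W : finType) (H : digraph W) :
  (2 <= #|edges H|)%N -> no_isolated H -> dag H -> ~ rooted_star H ->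
  exists side, two_way_cut H side.
Proof.
move=> e2 niH dH nstar; apply: contrapT => noc; apply: nstar.
have path_cut u v w : adj H u v -> adj H v w -> False.
  move=> uv vw; apply: noc; exists (pred1 v); split.
    exists v, w; split=> //=; by rewrite ?eqxx // eq_sym; exact: adj_neq vw.
  by exists u, v; split=> //=; rewrite ?eqxx //; exact: adj_neq uv.
have pair_meet u v x y : adj H u v -> adj H x y -> u = x \/ v = y.
  move=> uv xy; have [->|ux] := eqVneq u x; first by left.
  have [->|vy] := eqVneq v y; first by right.
  exfalso; apply: noc; exists (pred2 u y); split.
    exists u, v; split; rewrite //= ?eqxx // negb_or eq_sym.
    by rewrite (adj_neq uv).
  exists x, y; split; rewrite //= ?eqxx ?orbT // negb_or eq_sym ux.
  exact: adj_neq xy.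
have /card_gt1P[[u v] [[x y] [uv xy]]] := e2.
rewrite -/(adj H u v) in uv; rewrite -/(adj H x y) in xy => neq.
(* Every vertex other than [c] lies on some edge, and that edge must have its other end at [c]. *)
have star_of c : (forall a b, adj H a b -> a = c) \/ (forall a b, adj H a b -> b = c) ->
    star_with_center H c.
  move=> cP a b; apply/idP/andP => [ab|[anb]].
    split; first by case/orP: ab => /adj_neq; rewrite // eq_sym.
    case: cP => cP; case/orP: ab => /cP ->; by rewrite eqxx ?orbT.
  case/orP=> /eqP eqc; rewrite {}eqc in anb *.
    have [w] := niH b; case: cP => cP /orP[] bw.
    - by have E := cP _ _ bw; rewrite E in bw; rewrite bw.
    - by rewrite (cP _ _ bw) eqxx in anb.
    - by rewrite (cP _ _ bw) eqxx in anb.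
    - by have E := cP _ _ bw; rewrite E in bw; rewrite bw orbT.
  have [w] := niH a; case: cP => cP /orP[] bw.
  - by have E := cP _ _ bw; rewrite E in bw; rewrite bw orbT.
  - by rewrite (cP _ _ bw) eqxx in anb.
  - by rewrite (cP _ _ bw) eqxx in anb.
  - by have E := cP _ _ bw; rewrite E in bw; rewrite bw.
case: (pair_meet _ _ _ _ uv xy) => E; subst.
  have vy : v != y by apply: contra_neq neq => ->.
  have out a b : adj H a b -> a = x.
    move=> ab; case: (pair_meet _ _ _ _ ab uv) => // bv.
    case: (pair_meet _ _ _ _ ab xy) => // bv'.
    by move: vy; rewrite -bv -bv' eqxx.
  exists x; split; first by apply: star_of; left.
  left=> w; apply/negP => wx; move: (out _ _ wx) (adj_neq wx) => ->.
  by rewrite eqxx.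
have vy : u != x by apply: contra_neq neq => ->.
have inn a b : adj H a b -> b = y.
  move=> ab; case: (pair_meet _ _ _ _ ab uv) => // bv.
  case: (pair_meet _ _ _ _ ab xy) => // bv'.
  by move: vy; rewrite -bv -bv' eqxx.
exists y; split; first by apply: star_of; right.
right=> w; apply/negP => wx; move: (inn _ _ wx) (adj_neq wx) => ->.
by rewrite eqxx.
Qed.

Definition separated n (A B : {set 'I_n}) (pi : 'S_n) : Prop :=
  {in A & B, forall a b, (pi a < pi b)%N} \/ {in A & B, forall a b, (pi b < pi a)%N}.

Lemma separated_sub n (A B A' B' : {set 'I_n}) pi :
  A' \subset A -> B' \subset B -> separated A B pi -> separated A' B' pi.
Proof.
move=> /fintype.subsetP sA /fintype.subsetP sB [] s; [left|right] => a b /sA aA /sB bB; exact: s.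
Qed.

(** Scan positions up to the first threshold [j] below which [A] has [k] elements; it has exactly
    [k], as each position holds one point. If [B] also has [k] elements below [j], pair these with
    the upper part of [A]; otherwise pair the lower part of [A] with the upper part of [B]. *)
Lemma halve n (A B : {set 'I_n}) (pi : 'S_n) k :
  (2 * k <= #|A|)%N -> (2 * k <= #|B|)%N ->
  exists A' B' : {set 'I_n},
    [/\ A' \subset A, B' \subset B, (k <= #|A'|)%N, (k <= #|B'|)%N
      & separated A' B' pi].
Proof.
have [->|k_gt0] := posnP k.
  by move=> _ _; exists finset.set0, finset.set0; rewrite !finset.sub0set; split=> //; left=> a b; rewrite inE.
move=> kA kB.
pose low (X : {set 'I_n}) j := [set x in X | (pi x < j)%N].
have exj : exists j, (k <= #|low A j|)%N.
  exists n; suff -> : low A n = A by lia.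
  by apply/setP => x; rewrite inE ltn_ord andbT.
case: (ex_minnP exj) => j kj jmin.
have lowk : #|low A j| = k.
  apply/eqP; rewrite eqn_leq kj andbT; case: j kj jmin => [|j] _ jmin.
    rewrite (_ : low A 0 = finset.set0) ?cards0 //.
    by apply/setP => x; rewrite !inE ltn0 andbF.
  rewrite leqNgt; apply/negP => kS.
  have ltj : (#|low A j| < k)%N.
    by rewrite ltnNge; apply/negP => /jmin; rewrite ltnn.
  have : (#|low A j.+1 :\: low A j| <= 1)%N.
    apply/card_le1_eqP => x y; rewrite !inE.
    move=> /andP[xj /andP[xA xj']] /andP[yj /andP[yA yj']].
    apply: (@perm_inj _ pi); apply: val_inj; rewrite xA yA /= in xj yj *; lia.
  have := cardsD (low A j.+1) (low A j).
  have -> : low A j.+1 :&: low A j = low A j.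
    by apply/finset.setIidPr/fintype.subsetP => x; rewrite !inE => /andP[-> /ltnW].
  lia.
have cC (X : {set 'I_n}) : #|X :\: low X j| = (#|X| - #|low X j|)%N.
  rewrite cardsD; congr (_ - #|pred_of_set _|)%N; apply/finset.setIidPr/fintype.subsetP => x.
  by rewrite inE => /andP[].
have [kB'|kB'] := leqP k #|low B j|.
  exists (A :\: low A j), (low B j); split; rewrite ?finset.subsetDl ?cC //.
  - by apply/fintype.subsetP => x; rewrite inE => /andP[].
  - by rewrite lowk; lia.
  - right=> a b; rewrite !inE => /andP[aj aA] /andP[_ bj].
    by rewrite aA -leqNgt in aj; exact: leq_trans bj aj.
exists (low A j), (B :\: low B j); split; rewrite ?finset.subsetDl ?cC //.
- by apply/fintype.subsetP => x; rewrite inE => /andP[].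
- by lia.
- left=> a b; rewrite !inE => /andP[_ aj] /andP[bj bB].
  by rewrite bB -leqNgt in bj; exact: leq_trans aj bj.
Qed.

Lemma separated_by_all n (ps : seq 'S_n) (A B : {set 'I_n}) k :
  (2 ^ size ps * k <= #|A|)%N -> (2 ^ size ps * k <= #|B|)%N ->
  exists A' B' : {set 'I_n},
    [/\ A' \subset A, B' \subset B, (k <= #|A'|)%N, (k <= #|B'|)%N
      & forall pi, pi \in ps -> separated A' B' pi].
Proof.
elim: ps => [|pi ps IH] in A B *.
  by rewrite expn0 mul1n => kA kB; exists A, B; split.
rewrite /= expnS -mulnA => kA kB.
have [A1 [B1 [sA sB kA1 kB1 sep]]] := halve pi kA kB.
have [A2 [B2 [sA2 sB2 kA2 kB2 sep2]]] := IH _ _ kA1 kB1.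
exists A2, B2; split=> //; [exact: fintype.subset_trans sA|exact: fintype.subset_trans sB|].
move=> pi'; rewrite in_cons => /orP[/eqP ->|/sep2 //].
exact: separated_sub sep.
Qed.

(** The halving starts from an initial segment of ['I_n] and its complement; this first split
    accounts for the successor in the exponent. *)
Lemma disjoint_separated_sets n (ps : seq 'S_n) k :
  (2 ^ (size ps).+1 * k <= n)%N ->
  exists A B : {set 'I_n},
    [/\ [disjoint A & B], (k <= #|A|)%N, (k <= #|B|)%N
      & forall pi, pi \in ps -> separated A B pi].
Proof.
rewrite expnS -mulnA; set K := (2 ^ _ * k)%N => Kn.
have Kn' : (K <= n)%N by lia.
pose A := [set x : 'I_n | (x < K)%N].
have cA : #|A| = K.
  have wI : injective (widen_ord Kn') by move=> a b /(congr1 val) ab; exact: val_inj.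
  rewrite -(card_ord K) -(card_imset predT wI).
  apply: eq_card => x; rewrite inE; apply/idP/imsetP => [xK|[y _ ->]] /=; last exact: ltn_ord.
  by exists (Ordinal xK) => //; apply: val_inj.
have cB : (K <= #|~: A|)%N by have := cardsC A; rewrite card_ord; lia.
have [|A1 [B1 [sA sB kA1 kB1 sep]]] := @separated_by_all n ps A (~: A) k _ cB.
  by rewrite cA.
exists A1, B1; split=> //.
apply: disjointWl sA _; rewrite disjoint_sym; apply: disjointWl sB _.
by rewrite -setI_eq0 finset.setIC finset.setICr.
Qed.

(** The pieces are consecutive blocks of length [m] in an enumeration of [A], ordered by
    [enum_rank]. *)
Lemma disjoint_pieces (T W : finType) (A : {set T}) m :
  (m * #|W| <= #|A|)%N ->
  exists V : {ffun W -> {set T}},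
    [/\ forall w, V w \subset A, forall w, #|V w| = m
      & forall w w', w != w' -> [disjoint V w & V w']].
Proof.
move=> mA; pose s := enum A.
have lt (w : W) (j : 'I_m) : (enum_rank w * m + j < size s)%N.
  rewrite -cardE; apply: leq_trans mA; have := ltn_ord j; have := ltn_ord (enum_rank w).
  set r := nat_of_ord (enum_rank w); rewrite -/r => rW jm.
  apply: leq_trans (leq_mul (leqnn m) rW).
  by rewrite mulnS [(m * r)%N]mulnC addnC ltn_add2r.
(* An empty [T] offers no default for [nth]; then [m = 0] as soon as [W] has an element, and empty
   pieces will do. *)
have [x0 _|noT] := pickP (fun _ : T => true); last first.
  have m0 (w : W) : m = 0%N.
    case: (posnP m) => // m_gt0; have := lt w (Ordinal m_gt0).
    by case: s {lt} => // x; have := noT x.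
  exists [ffun=> finset.set0]; split=> [w|w|w w' _]; rewrite !ffunE ?finset.sub0set ?cards0 //.
    by rewrite (m0 w).
  by rewrite -setI_eq0 finset.set0I.
pose g (w : W) (j : 'I_m) := nth x0 s (enum_rank w * m + j).
have gI w w' j j' : g w j = g w' j' -> w = w' /\ j = j'.
  move/eqP; rewrite nth_uniq ?enum_uniq // => /eqP E.
  have m_gt0 : (0 < m)%N by apply: leq_ltn_trans (ltn_ord j).
  have jE := congr1 (modn^~ m) E; rewrite /= !modnMDl !modn_small // in jE.
  have wE := congr1 (divn^~ m) E; rewrite /= !divnMDl // !divn_small // !addn0 in wE.
  split; last exact: val_inj.
  by apply: enum_rank_inj; exact: val_inj.
exists [ffun w => [set g w j | j : 'I_m]]; split=> [w|w|w w' ww']; rewrite !ffunE.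
- apply/fintype.subsetP => x /imsetP[j _ ->].
  by rewrite -mem_enum; apply: mem_nth.
- by rewrite card_imset ?card_ord // => j j' /gI[].
- rewrite -setI_eq0; apply/finset.set0Pn => -[x]; rewrite inE.
  case/andP=> /imsetP[j _ ->] /imsetP[j' _ /gI[E _]].
  by rewrite E eqxx in ww'.
Qed.

(** * Copies of [H] with one vertex in each piece *)

Definition transversals (W T : finType) (V : W -> {set T}) : {set {ffun W -> T}} :=
  [set f : {ffun W -> T} | [forall w, f w \in V w]].

Lemma transversalsP (W T : finType) (V : W -> {set T}) (f : {ffun W -> T}) :
  reflect (forall w, f w \in V w) (f \in transversals V).
Proof. by rewrite inE; exact: forallP. Qed.

(** Injectivity of [f] is not demanded: it follows from disjointness of the classes. [E] is a bare
    edge set, so that the event makes sense under the product measure. *)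
Definition has_copy_in n (W : finType) (H : digraph W) (V : W -> {set 'I_n})
    (E : {set 'I_n * 'I_n}) : bool :=
  [exists f : {ffun W -> 'I_n}, (f \in transversals V) &&
     [forall e in edges H, (f e.1, f e.2) \in E]].

(** Vertices on [side] get pieces of [A], the others pieces of [B]. A permutation placing [A] before
    [B] reverses the edge entering [side]; one placing [B] before [A] reverses the edge leaving
    it. *)
Lemma uncovered_pieces n (W : finType) (H : digraph W) (side : W -> bool)
    (ps : seq 'S_n) m :
  two_way_cut H side -> (2 ^ (size ps).+1 * (m * #|W|) <= n)%N ->
  exists V : {ffun W -> {set 'I_n}},
    [/\ forall w, #|V w| = m, forall w w', w != w' -> [disjoint V w & V w']
      & forall (f : {ffun W -> 'I_n}) pi, f \in transversals V -> pi \in ps ->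
         exists2 e, e \in edges H & ~~ (pi (f e.1) < pi (f e.2))%N].
Proof.
move=> [[u [v [uv su sv]]] [x [y [xy sx sy]]]] mn.
have [A [B [dAB mA mB sep]]] := disjoint_separated_sets mn.
have [VA [sA cA dA]] := disjoint_pieces mA.
have [VB [sB cB dB]] := disjoint_pieces mB.
exists [ffun w => if side w then VA w else VB w]; split=> [w|w w' ww'|f pi].
- by rewrite ffunE; case: ifP.
- have d (a b : W) : [disjoint VA a & VB b].
    apply: disjointWl (sA a) _; rewrite disjoint_sym.
    by apply: disjointWl (sB b) _; rewrite disjoint_sym.
  rewrite !ffunE; case: ifP => _; case: ifP => _; rewrite ?dA ?dB //.
  by rewrite disjoint_sym.
- move=> /transversalsP fV pips.
  have fA w : side w -> f w \in A.
    by move=> sw; have := fV w; rewrite ffunE sw; apply/fintype.subsetP.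
  have fB w : ~~ side w -> f w \in B.
    by move=> sw; have := fV w; rewrite ffunE (negPf sw); apply/fintype.subsetP.
  case: (sep _ pips) => s.
    exists (x, y) => //=; rewrite -leqNgt ltnW //; apply: s; [exact: fA|exact: fB].
  exists (u, v) => //=; rewrite -leqNgt ltnW //; apply: s; [exact: fA|exact: fB].
Qed.

(** If [tau H G <= t], an optimal family of permutations yields pieces as in [uncovered_pieces], and
    the copy that [G] contains there is covered by none of them. *)
Lemma tau_lower n (W : finType) (H : digraph W) (G : digraph 'I_n) m t :
  (2 <= #|edges H|)%N -> no_isolated H -> dag H -> ~ rooted_star H ->
  (forall V : {ffun W -> {set 'I_n}}, (forall w, #|V w| = m) ->
     (forall w w', w != w' -> [disjoint V w & V w']) -> has_copy_in H V (edges G)) ->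
  (2 ^ t.+1 * (m * #|W|) <= n)%N -> (t < tau H G)%N.
Proof.
move=> e2 niH dH nstar copies mn; rewrite ltnNge; apply/negP => tau_t.
have [side cut] := two_way_cut_exists e2 niH dH nstar.
have : coverable H G (tau H G).
  rewrite /tau; case: pselect => [ex|[]]; last exact: dag_coverable.
  by case: ex_minnP.
case/existsP => ps /forallP cov.
have [|V [cV dV nV]] := uncovered_pieces (ps := ps) cut (m := m).
  apply: leq_trans mn; rewrite size_tuple leq_mul2r leq_pexp2l ?ltnS ?tau_t ?orbT //.
case/existsP: (copies _ cV dV) => f /andP[fV /forall_inP fG].
have fI : injective f.
  move=> w w' E; apply/eqP; apply: contraT => ww'.
  have /transversalsP fV' := fV; have := dV _ _ ww'; rewrite -setI_eq0 => /eqP/setP/(_ (f w)).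
  by rewrite !inE fV' E fV'.
pose X := ([set f w | w : W], [set (f e.1, f e.2) | e in edges H]).
have Xc : is_copy H G X.
  apply/andP; split; last first.
    apply/existsP; exists f; apply/and3P; split; rewrite ?eqxx //; exact/injectiveP.
  apply/andP; split; first by apply/fintype.subsetP => e /imsetP[e' /fG e'G ->].
  by apply/forall_inP => e /imsetP[e' _ ->] /=; rewrite !imset_f.
have := cov X; rewrite Xc /= => /hasP[pi pips /andP[/fintype.subsetP piX _]].
have [e eH] := nV f pi fV pips.
have : (f e.1, f e.2) \in X.2 by apply/imsetP; exists e.
by move/piX; rewrite inE /= => /andP[_ ->].
Qed.

(** * The logarithmic upper bound *)

(** A colouring is determined by its values on the image of [f] together with the colouring obtained
    by overwriting these with [r]. Hence a random colouring agrees with [r] along [f] with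
    probability at least [#|C| ^ - #|W|]. *)
Lemma card_extending_ffun (W T C : finType) (f : {ffun W -> T}) (r : W -> C) :
  injective f ->
  (#|{ffun T -> C}| <=
   #|{ffun W -> C}| * #|[set k : {ffun T -> C} | [forall w, k (f w) == r w]]|)%N.
Proof.
move=> fI; set K := [set k | _].
pose g (k : {ffun T -> C}) : {ffun W -> C} * {ffun T -> C} :=
  ([ffun w => k (f w)],
   [ffun x => if [pick w | f w == x] is Some w then r w else k x]).
have pickf w : [pick w' | f w' == f w] = Some w.
  by case: pickP => [w' /eqP/fI -> //|/(_ w)]; rewrite eqxx.
have gI : injective g.
  move=> k k' [/ffunP E1 /ffunP E2]; apply/ffunP => x.
  have := E2 x; rewrite !ffunE; case: pickP => // w /eqP <- _.
  by have := E1 w; rewrite !ffunE.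
rewrite -(card_imset predT gI) -cardsT -cardsX; apply/subset_leq_card/fintype.subsetP.
move=> _ /imsetP[k _ ->]; rewrite inE /= finset.in_setT inE; apply/forallP => w.
by rewrite ffunE pickf.
Qed.

(* By averaging, some element of [K] covers at least a proportion [b] of the
   elements that are still uncovered. *)
Lemma greedy_cover (R : realType) (F K : finType) (cov : K -> F -> bool) (b : R) :
  0 <= b <= 1 -> (forall f, b * #|K|%:R <= #|[set k | cov k f]|%:R) -> (0 < #|K|)%N ->
  forall t, exists ks : t.-tuple K,
    #|[set f | ~~ has (cov^~ f) ks]|%:R <= (1 - b) ^+ t * #|F|%:R.
Proof.
move=> /andP[b0 b1] hb K0; elim=> [|t [ks IH]].
  by exists [tuple]; rewrite expr0 mul1r ler_nat max_card.
set U := [set f | _] in IH.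
have [k hk] : exists k, b * #|U|%:R <= #|[set f in U | cov k f]|%:R.
  apply: contrapT => /forallNP nk.
  have /card_gt0P[k0 _] := K0.
  have : \sum_(k : K) #|[set f in U | cov k f]|%:R < \sum_(k : K) b * #|U|%:R :> R.
    apply: ltr_sum; first by apply/hasP; exists k0; rewrite ?mem_index_enum.
    by move=> k _; rewrite ltNge; apply/negP; exact: nk.
  rewrite ltNge; apply/negP/negPn.
  (* Double counting of the pairs [k], [f] with [f] in [U] covered by [k]. *)
  apply: (@le_trans _ _ (\sum_(f in U) b * #|K|%:R)).
    by rewrite !sumr_const -[leLHS]mulr_natr -[leRHS]mulr_natr mulrAC.
  have -> : \sum_(k : K) #|[set f in U | cov k f]|%:R =
      \sum_(f in U) #|[set k | cov k f]|%:R :> R.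
    rewrite -!natr_sum; congr _%:R.
    under eq_bigr do rewrite -sum1_card.
    under [RHS]eq_bigr do rewrite -sum1_card.
    rewrite (exchange_big_dep (mem U)) /=; last by move=> k f _; rewrite inE => /andP[].
    apply: eq_bigr => f fU; apply: eq_bigl => k.
    by rewrite [LHS]inE fU [RHS]inE.
  by apply: ler_sum => f _; exact: hb.
exists (cons_tuple k ks).
have -> : [set f | ~~ has (cov^~ f) (cons_tuple k ks)] = U :\: [set f in U | cov k f].
  apply/setP => f; rewrite !inE /= negb_or.
  by case: (has _ _); rewrite ?andbF ?andbT.
rewrite cardsD (finset.setIidPr _); last by apply/fintype.subsetP => f; rewrite inE => /andP[].
rewrite natrB; last first.
  by apply/subset_leq_card/fintype.subsetP => f; rewrite inE => /andP[].
rewrite exprS -mulrA; apply: (@le_trans _ _ ((1 - b) * #|U|%:R)).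
  by rewrite mulrBl mul1r lerD2l lerN2.
by apply: ler_wpM2l => //; rewrite subr_ge0.
Qed.

(** Each vertex of [H] is assigned its rank as a colour. Sorting ['I_n] by a colouring covers every
    embedding that sends each vertex to a point of its own colour, so [greedy_cover] applies with
    [F] the set of embeddings. *)
Lemma coverable_of_decay (R : realType) n (W : finType) (H : digraph W)
    (G : digraph 'I_n) t :
  dag H -> (0 < #|W|)%N ->
  (1 - (#|W| ^ #|W|)%:R^-1) ^+ t * (n ^ #|W|)%:R < 1 :> R ->
  coverable H G t.
Proof.
move=> dH W0 small.
pose rk w := #|[pred u | connect (adj H) u w]|.
have rkP u v : adj H u v -> (rk u < rk v)%N.
  move=> uv; apply: proper_card; apply/properP; split.
    apply/fintype.subsetP => w; rewrite !inE => wu.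
    by apply: connect_trans wu _; apply: connect1.
  by exists v; rewrite inE ?connect0 //; exact: dag_edge_connect.
(* Each vertex reaches itself, so [rk] is positive; lowering it by one fits ['I_#|W|] and keeps the
   order strict. *)
have rk_lt w : ((rk w).-1 < #|W|)%N.
  by have := max_card [pred u | connect (adj H) u w]; rewrite -/(rk w); lia.
pose r w := Ordinal (rk_lt w).
have rP u v : adj H u v -> (r u < r v)%N.
  move=> /rkP /= uv; have : (0 < rk u)%N.
    by apply/card_gt0P; exists u; rewrite inE connect0.
  lia.
pose F := [set f : {ffun W -> 'I_n} | injectiveb f].
pose K := {ffun 'I_n -> 'I_#|W|}.
pose cov (k : K) (f : {x | x \in F}) := [forall w, k (val f w) == r w].
have hW : 0 < (#|W| ^ #|W|)%:R :> R by rewrite ltr0n expn_gt0 W0.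
have cK : #|K| = (#|W| ^ n)%N by rewrite card_ffun !card_ord.
have [|||ks hks] := @greedy_cover R _ K cov (#|W| ^ #|W|)%:R^-1 _ _ _ t.
- by rewrite invr_ge0 ler0n invf_le1 // ler1n expn_gt0 W0.
- move=> f; rewrite mulrC ler_pdivrMr // -natrM ler_nat mulnC.
  have fI : injective (val f) by apply/injectiveP; have := valP f; rewrite inE.
  apply: leq_trans (card_extending_ffun r fI) _.
  by rewrite card_ffun card_ord leq_mul2l; apply/orP; right; apply: subset_leq_card.
- by rewrite cK expn_gt0 W0.
(* The number of uncovered embeddings is a natural number below 1. *)
have none : [set f | ~~ has (cov^~ f) ks] = finset.set0.
  apply/eqP; rewrite -cards_eq0 -leqn0 -ltnS -(ltr_nat R).
  apply: le_lt_trans hks (le_lt_trans _ small).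
  rewrite ler_wpM2l ?exprn_ge0 ?subr_ge0 ?invf_le1 ?ler1n ?expn_gt0 ?W0 //.
  rewrite ler_nat card_sig; apply: leq_trans (max_card _) _.
  by rewrite card_ffun card_ord.
have permk (k : K) : { pi : 'S_n | forall i j, (k i < k j)%N -> (pi i < pi j)%N }.
  exact: cid (perm_of_key (fun i => k i)).
apply/existsP; exists [tuple of [seq sval (permk k) | k <- ks]].
apply/forallP => X; apply/implyP => /andP[/andP[XG Xends]].
case/existsP => f /and3P[fI _ /eqP XE].
have fF : f \in F by rewrite inE.
have /setP/(_ (exist _ f fF)) := none; rewrite !inE => /negbFE/hasP[k kks /forallP kf].
apply/hasP; exists (sval (permk k)); first exact: map_f.
rewrite /subgraph Xends andbT; apply/fintype.subsetP => e eX.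
rewrite /= inE (fintype.subsetP XG) //=; apply: (svalP (permk k)).
move: eX; rewrite XE => /imsetP[[u v] uv ->] /=.
by rewrite (eqP (kf u)) (eqP (kf v)); exact: rP.
Qed.

(** There are at most [n ^ h] embeddings, and [t] greedy steps shrink their number by
    [(1 - h ^ - h) ^ t <= exp (- t / h ^ h)], so any [t > h * h ^ h * ln n] suffices. *)
Lemma tau_upper (R : realType) (W : finType) (H : digraph W) :
  dag H -> (0 < #|W|)%N ->
  exists2 C : R, 0 < C & forall n (G : digraph 'I_n), (2 <= n)%N ->
    (tau H G)%:R <= C * log2 n%:R.
Proof.
move=> dH W0; pose D : R := (#|W| * #|W| ^ #|W|)%:R.
have ln2 : 0 < ln 2 :> R by rewrite ln_gt0 // ltr1n.
have D0 : 0 <= D by rewrite ler0n.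
(* [D * ln 2] converts [D * ln n] to base 2; the added 1 absorbs the rounding of [t], as
   [log2 n >= 1]. *)
exists (D * ln 2 + 1); first by have := mulr_ge0 D0 (ltW ln2); lra.
move=> n G n2; have n0 : (0 : R) < n%:R by rewrite ltr0n; lia.
have lnn : ln 2 <= ln n%:R :> R by rewrite ler_ln ?posrE // ler_nat.
pose x := D * ln n%:R; have x0 : 0 <= x by rewrite mulr_ge0 // (le_trans (ltW ln2)).
pose t := (Num.truncn x).+1.
have xt : x < t%:R by exact: truncnS_gt.
have tx : t%:R <= x + 1 by rewrite /t -natr1 lerD2r truncn_le.
have : coverable H G t.
  apply: (@coverable_of_decay R) => //.
  set h := #|W|; set b := (h ^ h)%:R^-1.
  have hh : 0 < (h ^ h)%:R :> R by rewrite ltr0n expn_gt0 W0.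
  have b1 : b <= 1 by rewrite invf_le1 // ler1n expn_gt0 W0.
  apply: (@le_lt_trans _ _ (expR (- b * t%:R) * expR (h%:R * ln n%:R))).
    apply: ler_pM; rewrite ?exprn_ge0 ?subr_ge0 ?ler0n //.
      by rewrite mulrC expRM_natl lerXn2r ?nnegrE ?subr_ge0 ?expR_ge0 // expR_ge1Dx.
    by rewrite expRM_natl lnK ?posrE // natrX.
  rewrite -expRD expR_lt1 mulNr addrC subr_lt0.
  rewrite /b [X in _ < X]mulrC ltr_pdivlMr //; apply: le_lt_trans xt.
  by rewrite /x /D natrM; lra.
move=> cov; apply: (@le_trans _ _ t%:R).
  rewrite ler_nat /tau; case: pselect => [ex|[]]; last exact: dag_coverable.
  by case: ex_minnP => m _; apply.
apply: le_trans tx _; rewrite /log2 mulrDl mul1r; apply: lerD.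
  by rewrite [leRHS](_ : _ = x) // /x; field; exact: lt0r_neq0.
by rewrite ler_pdivlMr // mul1r.
Qed.

(** * Copies with prescribed vertex classes in the random digraph *)

(** Loops get probability 0, which makes the random digraph a product measure on all ordered pairs:
    edge sets with a loop have weight 0. *)
Definition arc_prob (R : realType) (T : finType) (p : R) (e : T * T) : R :=
  if e.1 != e.2 then p else 0.

Lemma arc_prob01 (R : realType) (T : finType) (p : R) (e : T * T) :
  0 <= p <= 1 -> 0 <= arc_prob p e <= 1.
Proof. by rewrite /arc_prob; case: ifP => // _ _; rewrite lexx ler01. Qed.

Lemma gnp_mean (R : realType) n (p : R) (g : {set 'I_n * 'I_n} -> R) :
  \sum_(G : digraph 'I_n) gnp_weight p G * g (edges G) =
  mean (@arc_prob R 'I_n p) g.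
Proof.
have l0 : loopless (finset.set0 : {set 'I_n * 'I_n}).
  by apply/forall_inP => e; rewrite inE.
rewrite /mean (bigID (@loopless 'I_n)) /= [X in _ = _ + X]big1 ?addr0; last first.
  move=> A; rewrite /loopless negb_forall_in => /exists_inP[e eA ee].
  by rewrite /subset_weight (bigD1 e) //= eA /arc_prob (negPf ee) !mul0r.
rewrite [RHS](reindex_onto (@edges 'I_n) (insubd (Digraph l0))) /=; last first.
  by move=> A lA; rewrite insubdK.
apply: eq_big => [G|G _].
  by rewrite (valKd (Digraph l0) G) eqxx andbT; symmetry; exact: (valP G).
congr (_ * _); rewrite /subset_weight (bigID (fun e : 'I_n * 'I_n => e.1 != e.2)) /=.
rewrite [X in _ = _ * X]big1 ?mulr1.
  by apply: eq_bigr => e ee; rewrite /arc_prob ee.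
move=> e ee; rewrite /arc_prob (negPf ee) subr0.
by case: ifP => // eG; have := valP G => /forall_inP/(_ e eG); rewrite (negPf ee).
Qed.

Lemma gnp_weight_ge0 (R : realType) n (p : R) (G : digraph 'I_n) :
  0 <= p <= 1 -> 0 <= gnp_weight p G.
Proof.
case/andP=> p0 p1; apply: prodr_ge0 => e _.
by case: ifP => _ //; rewrite subr_ge0.
Qed.

Lemma gnp_probC (R : realType) n (p : R) (P : pred (digraph 'I_n)) :
  gnp_prob p P = 1 - gnp_prob p (predC P).
Proof.
have : \sum_(G : digraph 'I_n) gnp_weight p G = 1.
  rewrite -(sum_subset_weight (@arc_prob R 'I_n p)).
  transitivity (\sum_(G : digraph 'I_n) gnp_weight p G * 1).
    by apply: eq_bigr => G _; rewrite mulr1.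
  by rewrite (gnp_mean p (fun=> 1)); apply: eq_bigr => A _; rewrite mulr1.
by rewrite (bigID P) /= => <-; rewrite addrK.
Qed.

Lemma gnp_prob_le1 (R : realType) n (p : R) (P : pred (digraph 'I_n)) :
  0 <= p <= 1 -> gnp_prob p P <= 1.
Proof.
move=> p01; rewrite gnp_probC gerBl; apply: sumr_ge0 => G _; exact: gnp_weight_ge0.
Qed.

Lemma gnp_prob_le (R : realType) n (p : R) (P : pred (digraph 'I_n))
    (Q : pred {set 'I_n * 'I_n}) :
  0 <= p <= 1 -> (forall G, P G -> Q (edges G)) ->
  gnp_prob p P <= \sum_(A | Q A) subset_weight (@arc_prob R 'I_n p) A.
Proof.
move=> p01 PQ.
have -> : \sum_(A | Q A) subset_weight (@arc_prob R 'I_n p) A =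
    mean (@arc_prob R 'I_n p) (fun A => (Q A)%:R).
  rewrite /mean big_mkcond; apply: eq_bigr => A _.
  by case: (Q A); rewrite ?mulr1 ?mulr0.
rewrite -gnp_mean /gnp_prob big_mkcond; apply: ler_sum => G _.
have w0 := gnp_weight_ge0 G p01.
case: ifP => [/PQ ->|_]; first by rewrite mulr1.
by rewrite mulr_ge0.
Qed.

(** * Overlaps of copies and the probability of having none *)

Lemma card_transversals (W T : finType) (V : W -> {set T}) :
  #|transversals V| = (\prod_w #|V w|)%N.
Proof.
transitivity #|family (fun w => mem (V w))|.
  by apply: eq_card => f; rewrite inE.
by rewrite card_family foldrE big_map big_enum.
Qed.

Definition image_edges (W T : finType) (E : {set W * W}) (f : W -> T) : {set T * T} :=
  [set (f e.1, f e.2) | e in E].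

Definition induced_edges (W : finType) (H : digraph W) (K : {set W}) : {set W * W} :=
  [set e in edges H | (e.1 \in K) && (e.2 \in K)].

Definition agreement (W T : finType) (f g : {ffun W -> T}) : {set W} :=
  [set w | f w == g w].

Lemma prod_arc_prob (R : realType) (T : finType) (p : R) (B : {set T * T}) :
  loopless B -> \prod_(e in B) arc_prob p e = p ^+ #|B|.
Proof.
move=> /forall_inP lB; rewrite -prodr_const; apply: eq_bigr => e eB.
by rewrite /arc_prob lB.
Qed.

Lemma transversals_inj (W T : finType) (V : W -> {set T}) f g u v :
  (forall w w', w != w' -> [disjoint V w & V w']) ->
  f \in transversals V -> g \in transversals V -> f u = g v -> u = v.
Proof.
move=> dV /transversalsP fV /transversalsP gV E; apply/eqP; apply: contraT => uv.
have := dV _ _ uv; rewrite -setI_eq0 => /eqP/setP/(_ (f u)).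
by rewrite !inE fV E gV.
Qed.

(** Disjoint classes reveal the index of each vertex, so a shared edge comes from the same edge of
    [H] under [f] and [g], with both ends in the agreement set. *)
Lemma image_edges_capE (W T : finType) (H : digraph W) (V : W -> {set T}) f g :
  (forall w w', w != w' -> [disjoint V w & V w']) ->
  f \in transversals V -> g \in transversals V ->
  image_edges (edges H) f :&: image_edges (edges H) g =
  image_edges (induced_edges H (agreement f g)) f.
Proof.
move=> dV fV gV; apply/setP => x; rewrite inE; apply/andP/imsetP.
  move=> [/imsetP[[u v] uv ->] /imsetP[[u' v'] uv' /= [E1 E2]]].
  have Eu := transversals_inj dV fV gV E1; have Ev := transversals_inj dV fV gV E2.
  by exists (u, v) => //; rewrite !inE uv /= E1 E2 Eu Ev !eqxx.
move=> [[u v]]; rewrite !inE /= => /andP[uv /andP[/eqP Eu /eqP Ev]] ->.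
split; first by apply/imsetP; exists (u, v).
by rewrite Eu Ev; apply/imsetP; exists (u, v).
Qed.

Lemma card_image_edges (W T : finType) (E : {set W * W}) (f : W -> T) :
  injective f -> #|image_edges E f| = #|E|.
Proof.
by move=> fI; apply: card_imset => -[a b] [c d] /= [/fI -> /fI ->].
Qed.

Lemma loopless_image_edges (W T : finType) (H : digraph W) (f : W -> T) :
  injective f -> loopless (image_edges (edges H) f).
Proof.
move=> fI; apply/forall_inP => e /imsetP[e' eH ->] /=.
by have := valP H => /forall_inP/(_ _ eH); apply: contra => /eqP/fI ->.
Qed.

Lemma loopless_setU (T : finType) (A B : {set T * T}) :
  loopless A -> loopless B -> loopless (A :|: B).
Proof.
move=> /forall_inP lA /forall_inP lB; apply/forall_inP => e.
by rewrite inE => /orP[/lA|/lB].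
Qed.

(** Given [f], at most [m ^ (h - #|K|)] transversals agree with it exactly on [K]. Pairs with
    agreement set [K] thus contribute at most [mu ^ 2 / (m ^ #|K| * p ^ e(K)) <= mu ^ 2 / L] to the
    sum in [janson], and there are [2 ^ h] sets [K]. *)
Lemma no_copy_prob (R : realType) n (W : finType) (H : digraph W)
    (V : W -> {set 'I_n}) (m : nat) (p L : R) :
  0 < p <= 1 -> 0 < L -> (0 < #|edges H|)%N ->
  (forall w, #|V w| = m) ->
  (forall w w', w != w' -> [disjoint V w & V w']) ->
  (forall K : {set W}, (0 < #|induced_edges H K|)%N ->
     L <= m%:R ^+ #|K| * p ^+ #|induced_edges H K|) ->
  \sum_(A | ~~ has_copy_in H V A) subset_weight (@arc_prob R 'I_n p) A <=
  expR (- (L / (2 ^ #|W| * 4)%:R)).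
Proof.
move=> /andP[p0 p1] L0 e0 cV dV hL.
have p01 : 0 <= p <= 1 by rewrite ltW.
pose S := @image_edges W 'I_n (edges H); set J := transversals V.
set h := #|W|; set eH := #|edges H|.
have fI (f : {ffun W -> 'I_n}) : f \in J -> injective f.
  by move=> fJ u v; exact: (transversals_inj dV fJ fJ).
have PS f : f \in J -> \prod_(e in S f) arc_prob p e = p ^+ eH.
  by move=> fJ; rewrite prod_arc_prob ?card_image_edges //; [exact: fI|exact/loopless_image_edges/fI].
have cJ : #|J| = (m ^ h)%N.
  by rewrite card_transversals (eq_bigr (fun=> m)) // prod_nat_const.
pose mu : R := (m ^ h)%:R * p ^+ eH.
have muE : \sum_(f in J) \prod_(e in S f) arc_prob p e = mu.
  by rewrite (eq_bigr (fun=> p ^+ eH)) // sumr_const cJ -mulr_natl.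
have indT : induced_edges H finset.setT = edges H.
  by apply/setP => e; rewrite !inE /= andbT.
have Lmu : L <= mu.
  have := hL finset.setT; rewrite indT => /(_ e0) /le_trans; apply.
  by rewrite /mu natrX cardsT.
have h2 : 0 < (2 ^ h)%:R :> R by rewrite ltr0n expn_gt0.
pose M := L / (2 ^ h)%:R.
have M0 : 0 < M by rewrite divr_gt0.
have Mmu : M <= mu.
  apply: le_trans Lmu; rewrite ler_pdivrMr // ler_peMr ?(ltW L0) //.
  by rewrite ler1n expn_gt0.
have mu0 : 0 < mu by exact: lt_le_trans Mmu.
(* This [q] minimises [- q * mu + q ^ 2 * mu ^ 2 / M], with value [- M / 4]; [M <= mu] keeps it
   below 1. *)
pose q := M / (2 * mu).
have q01 : 0 <= q <= 1.
  rewrite /q divr_ge0 ?(ltW M0) //=; last by rewrite mulr_ge0 // ltW.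
  have mu2 : 0 < 2 * mu by exact: mulr_gt0.
  rewrite ler_pdivrMr // mul1r (le_trans Mmu) //.
  by rewrite ler_peMl ?(ltW mu0) // ler1n.
have Delta_le : \sum_(f in J) \sum_(g in J | ~~ [disjoint S f & S g])
    \prod_(e in S f :|: S g) arc_prob p e <= mu ^+ 2 / M.
  have -> : mu ^+ 2 / M = \sum_(f in J) \sum_(K : {set W}) mu * p ^+ eH / L.
    rewrite !sumr_const cJ -cardsT -powersetT card_powerset cardsT.
    rewrite -mulrnA -[RHS]mulr_natl natrM /M /mu -/h.
    field; rewrite ?gt_eqF //.
  apply: ler_sum => f fJ; have fV : forall w, f w \in V w by exact/transversalsP.
  have step g : g \in J -> \prod_(e in S f :|: S g) arc_prob p e =
      p ^+ (eH + eH - #|induced_edges H (agreement f g)|).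
    move=> gJ; rewrite prod_arc_prob; last first.
      by apply: loopless_setU; apply: loopless_image_edges; exact: fI.
    rewrite cardsU (image_edges_capE H dV fJ gJ) !card_image_edges //; exact: fI.
  rewrite (partition_big (agreement f) predT) //=; apply: ler_sum => K _.
  (* If [K] spans no edge, the two copies are edge-disjoint and the pair is absent from the sum. *)
  have [K0|K0] := posnP #|induced_edges H K|.
    rewrite big1 ?divr_ge0 ?(ltW L0) // ?mulr_ge0 ?(ltW mu0) ?exprn_ge0 ?(ltW p0) //.
    move=> g /andP[/andP[gJ]]; rewrite -setI_eq0 (image_edges_capE H dV fJ gJ).
    move=> /set0Pn[x /imsetP[e eK _]] /eqP E; move: eK; rewrite E.
    by move/eqP: K0; rewrite cards_eq0 => /eqP ->; rewrite inE.
  have eKH : (#|induced_edges H K| <= eH)%N.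
    by apply/subset_leq_card/fintype.subsetP => e; rewrite inE => /andP[].
  have cK : (#|[set g in J | agreement f g == K]| <= m ^ #|~: K|)%N.
    pose V' w := if w \in K then [set f w] else V w.
    apply: (@leq_trans #|transversals V'|).
      apply/subset_leq_card/fintype.subsetP => g; rewrite inE => /andP[/transversalsP gV /eqP E].
      apply/transversalsP => w; rewrite /V'; case: ifP => // wK.
      by move: wK; rewrite -E !inE eq_sym.
    rewrite card_transversals (bigID (mem K)) /= big1 ?mul1n => [|w wK]; last first.
      by rewrite /V' wK cards1.
    rewrite (eq_bigr (fun=> m)) => [|w /negPf wK]; last by rewrite /V' wK cV.
    by rewrite prod_nat_const; apply/eq_leq; congr (_ ^ _)%N; apply: eq_card => w; rewrite !inE.
  apply: (@le_trans _ _ (\sum_(g in [set g in J | agreement f g == K])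
      p ^+ (eH + eH - #|induced_edges H K|))).
    rewrite big_mkcond [leRHS]big_mkcond; apply: ler_sum => g _.
    rewrite inE; have [gJ|//] := boolP (g \in J); rewrite /=.
    have [E|_] := eqVneq (agreement f g) K; last by rewrite andbF.
    rewrite andbT -E -step //; case: ifP => // _.
    by apply: prodr_ge0 => e _; case/andP: (arc_prob01 e p01).
  rewrite sumr_const -mulr_natl.
  apply: (@le_trans _ _ ((m ^ #|~: K|)%:R * p ^+ (eH + eH - #|induced_edges H K|))).
    by rewrite ler_wpM2r ?exprn_ge0 ?(ltW p0) ?ler_nat.
  rewrite ler_pdivlMr //; apply: le_trans (ler_wpM2l _ (hL K K0)) _.
    by rewrite mulr_ge0 ?ler0n ?exprn_ge0 ?(ltW p0).
  have mE : (m ^ #|~: K|)%:R * m%:R ^+ #|K| = (m ^ h)%:R :> R.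
    by rewrite !natrX -exprD addnC cardsC.
  have pE : p ^+ (eH + eH - #|induced_edges H K|) * p ^+ #|induced_edges H K| =
      p ^+ eH * p ^+ eH.
    by rewrite -!exprD subnK // (leq_trans eKH) // leq_addr.
  by rewrite mulrACA mE pE /mu mulrA.
have /le_trans := janson (fun e => arc_prob01 e p01) q01 muE Delta_le.
rewrite (eq_bigl (fun A => ~~ has_copy_in H V A)); last first.
  move=> A; rewrite /has_copy_in negb_exists; apply: eq_forallb => f.
  rewrite negb_and implybE; congr (_ || ~~ _).
  apply/fintype.subsetP/forall_inP => [sA e eH'|sA x /imsetP[e eH' ->]]; last exact: sA.
  by apply: sA; apply/imsetP; exists e.
have -> : L / (2 ^ #|W| * 4)%:R = M / 4 by rewrite natrM invfM mulrA.
apply; rewrite ler_expR.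
have -> : q * mu = M / 2 by rewrite /q; field; rewrite gt_eqF.
have -> : q ^+ 2 * (mu ^+ 2 / M) = M / 4.
  by rewrite /q; field; rewrite !gt_eqF.
by lra.
Qed.

Lemma sum_exists_le (R : realType) (I T : finType) (w : T -> R)
    (J : pred I) (Q : I -> pred T) :
  (forall x, 0 <= w x) ->
  \sum_(x | [exists i, J i && Q i x]) w x <= \sum_(i | J i) \sum_(x | Q i x) w x.
Proof.
move=> w0; rewrite (exchange_big_dep predT) //= big_mkcond; apply: ler_sum => x _.
case: existsP => [[i /andP[Ji Qi]]|_]; last exact: sumr_ge0.
by rewrite (bigD1 i) ?Ji //= lerDl sumr_ge0.
Qed.

(** Union bound over the families of pieces, of which there are at most [(2 ^ n) ^ #|W|]. *)
Lemma tau_gt_prob (R : realType) n (W : finType) (H : digraph W)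
    (m t : nat) (p L : R) :
  (2 <= #|edges H|)%N -> no_isolated H -> dag H -> ~ rooted_star H ->
  0 < p <= 1 -> 0 < L ->
  (forall K : {set W}, (0 < #|induced_edges H K|)%N ->
     L <= m%:R ^+ #|K| * p ^+ #|induced_edges H K|) ->
  (2 ^ t.+1 * (m * #|W|) <= n)%N ->
  1 - (2 ^ (n * #|W|))%:R * expR (- (L / (2 ^ #|W| * 4)%:R)) <=
  gnp_prob p (fun G : digraph 'I_n => (t < tau H G)%N).
Proof.
move=> e2 niH dH nstar p01 L0 hL mn.
have p01' : 0 <= p <= 1 by case/andP: p01 => /ltW -> ->.
pose J (V : {ffun W -> {set 'I_n}}) := [forall w, #|V w| == m] &&
  [forall w, forall w', (w != w') ==> [disjoint V w & V w']].
pose Q (V : {ffun W -> {set 'I_n}}) A := ~~ has_copy_in H V A.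
rewrite gnp_probC lerD2l lerN2.
apply: le_trans (gnp_prob_le (Q := fun A => [exists V, J V && Q V A]) p01' _) _.
  move=> G /= ntau; apply: contraR ntau => /existsPn noV.
  apply: (tau_lower (m := m)) => // V cV dV.
  have := noV V; rewrite negb_and => /orP[|/negPn //].
  rewrite /J (_ : [forall w, _]); last by apply/forallP => w; rewrite cV.
  by case/negP; apply/forallP => w; apply/forallP => w'; apply/implyP; exact: dV.
apply: le_trans (sum_exists_le _ _ _) _.
  by move=> A; apply: subset_weight_ge0 => e; exact: arc_prob01.
apply: (@le_trans _ _ (\sum_(V | J V) expR (- (L / (2 ^ #|W| * 4)%:R)))).
  apply: ler_sum => V /andP[/forallP cV /forallP dV].
  apply: (no_copy_prob (m := m)) => //; first exact: ltnW.
    by move=> w; apply/eqP.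
  by move=> w w'; have /forallP/(_ w')/implyP := dV w.
rewrite sumr_const -[leLHS]mulr_natl ler_wpM2r ?expR_ge0 // ler_nat.
apply: leq_trans (max_card _) _.
by rewrite card_ffun -cardsT -powersetT card_powerset cardsT card_ord expnM.
Qed.

(** * Fractional arboricity and the choice of exponents *)

Lemma induced_edges_le (R : realType) (W : finType) (H : digraph W) (K : {set W}) :
  (0 < #|induced_edges H K|)%N ->
  (#|induced_edges H K|)%:R <= frac_arboricity R H * (#|K|%:R - 1) /\ (1 < #|K|)%N.
Proof.
move=> K0.
have K1 : (1 < #|K|)%N.
  have /card_gt0P[[u v]] := K0; rewrite inE /= => /andP[uv /andP[uK vK]].
  apply/card_gt1P; exists u, v; split=> //; exact: adj_neq uv.
split=> //; rewrite -ler_pdivrMr ?subr_gt0 ?ltr1n //.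
rewrite /frac_arboricity.
apply: (@le_bigmax_cond _ _ _ _ (K, induced_edges H K) _
  (fun X : {set W} * {set W * W} => #|X.2|%:R / (#|X.1|%:R - 1))).
rewrite /= K1 andbT /subgraph /=; apply/andP; split.
  by apply/fintype.subsetP => e; rewrite inE => /andP[].
by apply/forall_inP => e; rewrite inE => /andP[].
Qed.

Lemma powR_eventually_ge (R : realType) (e C : R) :
  0 < e -> exists N, forall n, (N <= n)%N -> C <= n%:R `^ e.
Proof.
move=> e0; pose D := Num.max C 1; have D0 : 0 < D by rewrite lt_max ltr01 orbT.
exists (Num.truncn (D `^ e^-1)).+1 => n hn.
have CD : C <= D by rewrite le_max lexx.
apply: le_trans CD _.
rewrite -[leLHS](powRr1 (ltW D0)) -[X in D `^ X](mulVf (lt0r_neq0 e0)) powRrM.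
rewrite ge0_ler_powR ?nnegrE ?powR_ge0 ?ler0n ?(ltW e0) //.
by apply: le_trans (ltW (truncnS_gt _)) _; rewrite ler_nat.
Qed.

Lemma gnp_prob_mono (R : realType) n (p : R) (P Q : pred (digraph 'I_n)) :
  0 <= p <= 1 -> (forall G, P G -> Q G) -> gnp_prob p P <= gnp_prob p Q.
Proof.
move=> p01 PQ; rewrite /gnp_prob big_mkcond [leRHS]big_mkcond.
apply: ler_sum => G _; case: ifP => [/PQ ->//|_].
by case: ifP => // _; exact: gnp_weight_ge0.
Qed.

Lemma gnp_exponent01 (R : realType) (a : R) n :
  0 <= a -> (0 < n)%N -> 0 < n%:R `^ (- a^-1) <= 1.
Proof.
move=> a0 n0; rewrite powR_gt0 ?ltr0n //=.
rewrite -[leRHS](powRr0 n%:R); apply: ler_powR; first by rewrite ler1n.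
by rewrite oppr_le0 invr_ge0.
Qed.

Lemma tau_lower_prob (R : realType) (W : finType) (H : digraph W) (a : R) :
  (2 <= #|edges H|)%N -> no_isolated H -> dag H -> ~ rooted_star H ->
  frac_arboricity R H < a ->
  0 < a /\ exists c : R, 0 < c /\ exists N, forall n, (N <= n)%N ->
    1 - expR (-1) ^+ n <=
    gnp_prob (n%:R `^ (- a^-1)) (fun G : digraph 'I_n => c * log2 n%:R <= (tau H G)%:R).
Proof.
move=> e2 niH dH nstar; set a0 := frac_arboricity R H => a0a.
set h := #|W|.
have indT : induced_edges H finset.setT = edges H.
  by apply/setP => e; rewrite !inE /= andbT.
have [|eT hT] := @induced_edges_le R _ H finset.setT; first by rewrite indT ltnW.
have a0_gt0 : 0 < a0.
  rewrite -(pmulr_lgt0 _ (x := #|[set: W]|%:R - 1)) ?subr_gt0 ?ltr1n //.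
  by apply: lt_le_trans eT; rewrite indT ltr0n ltnW.
have a_gt0 : 0 < a by exact: lt_trans a0a.
split=> //.
have h1 : (1 < h)%N by rewrite /h -cardsT.
have hR : 2 <= h%:R :> R by rewrite ler_nat.
(* [g] is the slack in [a0 < a]. With [m] near [n ^ (1 - d)], the choice of [d] limits the loss in
   [m ^ #|K|] to [n ^ (g / 2)]. *)
pose g := 1 - a0 / a.
have g_gt0 : 0 < g by rewrite subr_gt0 ltr_pdivrMr // mul1r.
have g_lt1 : g < 1 by rewrite gtrBl divr_gt0.
pose d := g / (2 * h%:R).
have d_gt0 : 0 < d by rewrite divr_gt0 // mulr_gt0 //; lra.
have dh : d * h%:R = g / 2 by rewrite /d; field; lra.
have d_lt1 : d < 1.
  have := ler_wpM2l (ltW d_gt0) hR; rewrite dh; lra.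
pose ep := g / 2; pose c := d / 2.
have ep_gt0 : 0 < ep by rewrite /ep; lra.
have c_gt0 : 0 < c by rewrite /c; lra.
have ln2_gt0 : 0 < ln 2 :> R by rewrite ln_gt0 // ltr1n.
(* In [4 * h], one 2 comes from [2 ^ t.+1] and one from rounding [m]. The second threshold makes the
   Janson exponent beat the [2 ^ (n * h)] families with [exp (- n)] to spare. *)
have [N1 hN1] := powR_eventually_ge (4 * h%:R) c_gt0.
have [N2 hN2] := powR_eventually_ge ((2 ^ h * 4)%:R * (h%:R * ln 2 + 1)) ep_gt0.
exists c; split=> //; exists (maxn 1 (maxn N1 N2)) => n.
rewrite !geq_max => /and3P[n1 /hN1 {}hN1 /hN2 {}hN2].
set x : R := n%:R in hN1 hN2 *.
have x1 : 1 <= x by rewrite ler1n.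
have x0 : 0 < x by exact: lt_le_trans x1.
have p01 : 0 < x `^ (- a^-1) <= 1 by apply: gnp_exponent01; rewrite ?(ltW a_gt0).
have p01' : 0 <= x `^ (- a^-1) <= 1 by case/andP: p01 => /ltW -> ->.
pose y := x `^ (1 - d).
have y1 : 1 <= y by rewrite -[leLHS](powRr0 x); apply: ler_powR => //; lra.
have [m ym my] : exists2 m : nat, y <= m%:R & m%:R <= 2 * y.
  exists (Num.truncn y).+1; first exact/ltW/truncnS_gt.
  have : (Num.truncn y)%:R <= y by rewrite truncn_le; lra.
  rewrite -natr1; lra.
have log0 : 0 <= c * log2 x.
  apply: mulr_ge0; first exact: ltW.
  by apply: divr_ge0; [exact: ln_ge0 | exact: ltW].
(* With this floor, [t < tau H G] gives [c * log2 x < t.+1 <= tau H G]. *)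
have [t t_le t_gt] : exists2 t : nat, t%:R <= c * log2 x & c * log2 x < t.+1%:R.
  by exists (Num.truncn (c * log2 x)); rewrite ?truncn_le ?truncnS_gt.
have pow2 k : 2 ^+ k = expR (k%:R * ln 2) :> R.
  by rewrite expRM_natl lnK // posrE.
have t2 : 2 ^+ t <= x `^ c.
  rewrite pow2 /powR (gt_eqF x0) ler_expR.
  by move: t_le; rewrite /log2 mulrA ler_pdivlMr.
have L0 : 0 < x `^ (1 + ep) by exact: powR_gt0.
(* The exponent is at least [(1 - d) k - e / a >= k - g / 2 - (1 - g) (k - 1) = 1 + g (k - 1) - g /
   2 >= 1 + g / 2], as [k >= 2]. *)
have hL (K : {set W}) : (0 < #|induced_edges H K|)%N ->
     x `^ (1 + ep) <= m%:R ^+ #|K| * (x `^ (- a^-1)) ^+ #|induced_edges H K|.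
  move=> /(@induced_edges_le R)[eK K1].
  set k := #|K| in eK K1 *; set e := #|induced_edges H K| in eK *.
  have kh : (k%:R : R) <= h%:R by rewrite ler_nat; exact: max_card.
  have k2 : 2 <= k%:R :> R by rewrite ler_nat.
  apply: (@le_trans _ _ (y ^+ k * (x `^ (- a^-1)) ^+ e)); last first.
    apply: ler_wpM2r; first by apply: exprn_ge0; exact: powR_ge0.
    by apply: lerXn2r; rewrite ?nnegrE ?ym //; lra.
  have powXn z j : (x `^ z) ^+ j = x `^ (z * j%:R).
    by rewrite powRrM powR_mulrn ?powR_ge0.
  rewrite /y !powXn -powRD; last by apply/implyP => _; rewrite gt_eqF.
  apply: ler_powR => //.
  have ae : a^-1 * e%:R <= (1 - g) * (k%:R - 1).
    have -> : (1 - g) * (k%:R - 1) = a^-1 * (a0 * (k%:R - 1)).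
      by rewrite /g; ring.
    by rewrite ler_wpM2l // invr_ge0 ltW.
  have dk : d * k%:R <= g / 2 by rewrite -dh ler_wpM2l // ltW.
  have gk : g <= g * (k%:R - 1) by rewrite ler_peMr ?(ltW g_gt0) //; lra.
  rewrite /ep; lra.
(* As [d = 2 c], the left side is at most [4 h x ^ (1 - c)], and [4 h <= x ^ c]. *)
have size_ok : (2 ^ t.+1 * (m * h) <= n)%N.
  rewrite -(ler_nat R) -/x !natrM natrX exprS.
  have xE : x = x `^ c * (x `^ c * y).
    rewrite /y -!powRD; try by apply/implyP => _; rewrite gt_eqF.
    have -> : c + (c + (1 - d)) = 1 by rewrite /c; lra.
    by rewrite powRr1 // ltW.
  apply: (@le_trans _ _ (4 * h%:R * (x `^ c * y))); last first.
    by rewrite [leRHS]xE ler_wpM2r // mulr_ge0 ?powR_ge0.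
  have -> : 4 * h%:R * (x `^ c * y) = 2 * x `^ c * (2 * y * h%:R) by ring.
  apply: ler_pM.
  - by apply: mulr_ge0 => //; exact: exprn_ge0.
  - exact: mulr_ge0.
  - exact: ler_wpM2l.
  - exact: ler_wpM2r.
apply: le_trans (le_trans (tau_gt_prob e2 niH dH nstar p01 L0 hL size_ok) _).
  rewrite lerD2l lerN2 natrX pow2 -expRD -expRM_natl ler_expR.
  have : x * (h%:R * ln 2 + 1) <= x `^ (1 + ep) / (2 ^ h * 4)%:R.
    rewrite ler_pdivlMr; last by rewrite ltr0n muln_gt0 expn_gt0.
    rewrite powRD; last by apply/implyP => _; rewrite gt_eqF.
    by rewrite powRr1 ?(ltW x0) // -mulrA ler_wpM2l ?(ltW x0) // mulrC.
  rewrite natrM -/x; lra.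
apply: gnp_prob_mono => // G tG; apply: le_trans (ltW t_gt) _.
by rewrite ler_nat.
Qed.

(** * Passage to the limit *)

Local Open Scope classical_set_scope.

Theorem theorem2 (R : realType) (W : finType) (H : digraph W)
    (edges_ge2 : (2 <= #|edges H|)%N) (H_no_isolated : no_isolated H)
    (H_dag : dag H) (H_not_star : ~ rooted_star H)
    (a_star : R) (a_star_gt : frac_arboricity R H < a_star) :
  (exists c_star : R, 0 < c_star /\
     aas (fun n => n%:R `^ (- a_star^-1))
         (fun n G => c_star * log2 n%:R <= (tau H G)%:R)) /\
  (exists c C : R, [/\ 0 < c, 0 < C &
     aas (fun n => n%:R `^ (- a_star^-1))
         (fun n G => c * log2 n%:R <= (tau H G)%:R <= C * log2 n%:R)]).
Proof.
have [a0 [c [c0 [N hN]]]] := tau_lower_prob edges_ge2 H_no_isolated H_dag H_not_star a_star_gt.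
have W0 : (0 < #|W|)%N.
  have /card_gt0P[[u v] _] := ltnW edges_ge2.
  by apply/card_gt0P; exists u.
have [C C0 hC] := @tau_upper R W H H_dag W0.
have lim1 : 1 - expR (-1) ^+ n @[n --> \oo] --> (1 : R).
  rewrite -[X in _ --> X]subr0; apply: cvgB; first exact: cvg_cst.
  apply: cvg_expr; rewrite ger0_norm ?expR_ge0 // expR_lt1; lra.
(* The upper bound on [tau] holds for every digraph once [n >= 2], so both claims follow from the
   lower-bound event, whose probability is squeezed between [1 - exp (- n)] and 1. *)
have aas_of (P : forall n, pred (digraph 'I_n)) :
    (forall n (G : digraph 'I_n), (2 <= n)%N -> c * log2 n%:R <= (tau H G)%:R -> P n G) ->
    aas (fun n => n%:R `^ (- a_star^-1)) P.
  move=> hP; rewrite /aas; refine (squeeze_cvgr _ lim1 (cvg_cst (1 : R))).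
  exists (maxn 2 N) => // n /=; rewrite geq_max => /andP[n2 Nn].
  have p01 : 0 <= (n%:R : R) `^ (- a_star^-1) <= 1.
    by have /andP[/ltW -> ->] := gnp_exponent01 (ltW a0) (ltnW n2).
  rewrite gnp_prob_le1 // andbT; apply: le_trans (hN n Nn) _.
  by apply: gnp_prob_mono => // G; exact: hP.
split; first by exists c; split=> //; exact: aas_of.
exists c, C; split=> //; apply: aas_of => n G n2 cG.
by rewrite cG hC.
Qed.
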